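(* Let $D>1$ be real and let $(V,\omega,\mu)$ be the radial path graph with parameter $D$ (defined in the context). Then the following estimates hold. (i) If $p>D$, there exists a constant $c>0$, depending only on $p,D$, such that, for every nonempty finite $\Omega\subset V$ with $\tau_\Omega\ge2$ and every $w:\Omega\to[0,\infty)$ with $w\not\equiv0$, $$\lambda_{1,p}(\Omega,w)\ge\frac{c}{\tau_\Omega^{\,p-D}\,\|w\|_{\ell^1(\Omega,\mu)}}.$$ (ii) If $p=D$, there exists a constant $c>0$, depending only on $D$, such that, for every nonempty finite $\Omega\subset V$ with $\tau_\Omega\ge2$ and every $w:\Omega\to[0,\infty)$ with $w\not\equiv0$, $$\lambda_{1,p}(\Omega,w)\ge\frac{c}{(\log\tau_\Omega)^{p-1}\,\|w\|_{\ell^1(\Omega,\mu)}}.$$ (iii) If $1<p<D$ and $s>D/p$, there exists a constant $c>0$, depending only on $p,D,s$, such that, for every nonempty finite $\Omega\subset V$ with $\tau_\Omega\ge2$ and every $w:\Omega\to[0,\infty)$ with $w\not\equiv0$, $$\lambda_{1,p}(\Omega,w)\ge\frac{c}{\tau_\Omega^{\,p-\frac{D}{s}}\,\|w\|_{\ell^s(\Omega,\mu)}}.$$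
   Context: The radial path graph with parameter $D>1$ has vertex set $V=\mathbb{N}_0=\{0,1,2,\dots\}$, adjacency $m\sim n$ iff $|m-n|=1$, vertex measure $\mu(n)=(n+1)^{D-1}$, and edge weights $\omega_{n,n+1}=\omega_{n+1,n}=(n+1)^{D-1}$ for $n\in\mathbb{N}_0$, all other weights being zero. For a nonempty finite $\Omega\subset V$, the radial outer radius is $\tau_\Omega=\max\{n:n\in\Omega\}$. $X_V(\Omega)=\{u:V\to\mathbb{R}:u=0\text{ in }V\setminus\Omega\}$; for $1<p<\infty$, $E_p(u)=\frac12\sum_{x,y\in V}\omega_{xy}|u(y)-u(x)|^p$; for $1\le r<\infty$, $\|f\|_{\ell^r(\Omega,\mu)}=(\sum_{x\in\Omega}\mu(x)|f(x)|^r)^{1/r}$. The first weighted Dirichlet eigenvalue is $$\lambda_{1,p}(\Omega,w)=\inf\left\{\frac{E_p(u)}{\sum_{x\in\Omega}\mu(x)w(x)|u(x)|^p}:\ u\in X_V(\Omega),\ \sum_{x\in\Omega}\mu(x)w(x)|u(x)|^p>0\right\}.$$ *)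

(* Defs.v *)
From HB Require Import structures.
From mathcomp Require Import all_boot all_order all_algebra finmap.
From mathcomp Require Import all_classical all_reals all_analysis.

Set Implicit Arguments.
Unset Strict Implicit.
Unset Printing Implicit Defensive.

Import Order.TTheory GRing.Theory Num.Theory.

Local Open Scope classical_set_scope.
Local Open Scope ring_scope.

Section WeightedGraph.
Context {R : realType} {V : choiceType}.
Variables (omega : V -> V -> R) (mu : V -> R).

Definition vanishing_outside (Omega : {fset V}) : set (V -> R) :=
  [set u | forall x, x \notin Omega -> u x = 0].

(* The sum over V x V is an unordered sum of nonnegative terms, hence takes
   values in \bar R. *)
Definition energy (p : R) (u : V -> R) : \bar R :=
  ((2^-1)%:E *
   \esum_(z in [set: V * V]) (omega z.1 z.2 * `|u z.2 - u z.1| `^ p)%:E)%E.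

(* Functions on Omega are represented by functions on V, of which only the
   values on Omega are used. *)
Definition lnorm (Omega : {fset V}) (r : R) (f : V -> R) : R :=
  (\sum_(x <- Omega) mu x * `|f x| `^ r) `^ r^-1.

Definition wmass (Omega : {fset V}) (p : R) (w u : V -> R) : R :=
  \sum_(x <- Omega) mu x * w x * `|u x| `^ p.

Definition lambda1 (p : R) (Omega : {fset V}) (w : V -> R) : \bar R :=
  ereal_inf [set (energy p u / (wmass Omega p w u)%:E)%E |
    u in [set u | vanishing_outside Omega u /\ 0 < wmass Omega p w u]].

Definition weight_on (Omega : {fset V}) (w : V -> R) : Prop :=
  (forall x, x \in Omega -> 0 <= w x) /\ (exists2 x, x \in Omega & w x != 0).

End WeightedGraph.

Section RadialPath.
Context {R : realType}.
Variable D : R.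

Definition radial_adj (m n : nat) : bool := (n == m.+1) || (m == n.+1).

Definition radial_mu (n : nat) : R := n.+1%:R `^ (D - 1).

Definition radial_omega (m n : nat) : R :=
  if radial_adj m n then (minn m n).+1%:R `^ (D - 1) else 0.

Definition radial_lambda1 (p : R) (Omega : {fset nat}) (w : nat -> R) : \bar R :=
  lambda1 radial_omega radial_mu p Omega w.

Definition radial_lnorm (Omega : {fset nat}) (r : R) (f : nat -> R) : R :=
  lnorm radial_mu Omega r f.

End RadialPath.

Definition outer_radius (Omega : {fset nat}) : nat := (\max_(n <- Omega) n)%N.

(* Main.v *)
Require Import Defs.
From mathcomp Require Import all_boot all_order all_algebra finmap.
From mathcomp Require Import all_classical all_reals all_analysis.
From mathcomp Require Import ring lra.

Import Order.TTheory GRing.Theory Num.Theory.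

Local Open Scope fset_scope.
Local Open Scope ring_scope.

(** The three estimates come from one pointwise bound. A function u that
    vanishes outside Omega vanishes at m = tau + 1, where tau is the outer
    radius, so u n is the telescoping sum of u k - u k.+1 over n <= k < m.
    Hoelder's inequality, with weights chosen so that the energy appears, gives
    [|u n|^p <= R(n, m)^(p - 1) * E_p(u)], where
    [R(n, m) = \sum_(n <= k < m) (k + 1)^(- (D - 1) / (p - 1))]
    is the p-resistance of the path from n to m ([powR_le_energy]). Summing
    against mu w bounds the weighted mass of u by
    [\sum_(x in Omega) mu(x) w(x) R(x, m)^(p - 1)] times the energy, hence
    bounds lambda_{1,p} from below by the inverse of that sum ([lambda1_ge]).

    It remains to estimate power sums. If p > D, the exponent in R exceeds -1
    and R(0, m) is at most a constant times tau^((p - D) / (p - 1)); if p = D,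
    R(0, m) is a harmonic sum, at most a constant times log tau; in both cases
    R(x, m) <= R(0, m) leaves the l^1 norm of w. If p < D, the resistance to
    infinity is finite and R(x, m)^(p - 1) is at most a constant times
    (x + 1)^(p - D). Hoelder's inequality with exponents s and t = s / (s - 1)
    then separates w from this power, and
    [\sum_(x <= tau) (x + 1)^(D - 1 + (p - D) t)] is at most a constant times
    tau^(D + (p - D) t), whose exponent is positive exactly when s > D / p. *)

(** * Hoelder's inequality for weighted finite sums *)

(** Young's inequality for [a / A `^ p^-1] and [b / B `^ q^-1], written without
    these quotients; when A and B are the p-th and q-th power sums, summing the
    bracket gives 1. *)
Lemma young_normalized {R : realType} (p q a b A B : R) :
    0 < p -> 0 < q -> p^-1 + q^-1 = 1 -> 0 <= a -> 0 <= b -> 0 < A -> 0 < B ->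
  a * b <= A `^ p^-1 * B `^ q^-1 * (a `^ p / A / p + b `^ q / B / q).
Proof.
move=> p0 q0 pq a0 b0 A0 B0.
have Ap : 0 < A `^ p^-1 by exact: powR_gt0.
have Bq : 0 < B `^ q^-1 by exact: powR_gt0.
have a'0 : 0 <= a / A `^ p^-1 by rewrite divr_ge0// ltW.
have b'0 : 0 <= b / B `^ q^-1 by rewrite divr_ge0// ltW.
have := conjugate_powR a'0 b'0 p0 q0 pq.
have powK c C t : 0 < t -> 0 <= c -> 0 < C ->
    (c / C `^ t^-1) `^ t = c `^ t / C :> R.
  move=> t0 c0 C0.
  rewrite powRM ?invr_ge0 ?powR_ge0//.
  by rewrite -[in LHS]powRN -powRrM mulNr mulVf ?gt_eqF// powR_inv1 ?ltW.
rewrite !powK// => young.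
rewrite -(ler_pdivrMl _ _ (mulr_gt0 Ap Bq)).
by rewrite invfM mulrC mulrACA.
Qed.

Section WeightedHoelder.
Context {R : realType} {I : eqType}.
Variables (r : seq I) (m : I -> R).
Hypothesis m_ge0 : forall i, 0 <= m i.

Lemma wsum_mul_eq0 (p : R) (a b : I -> R) : (forall i, 0 <= a i) ->
  \sum_(i <- r) m i * a i `^ p = 0 -> \sum_(i <- r) m i * (a i * b i) = 0.
Proof.
move=> a_ge0 /eqP; rewrite psumr_eq0; last first.
  by move=> i _; rewrite mulr_ge0 ?powR_ge0.
move=> /allP a0; apply: big1_seq => i /andP[_ ir].
have := a0 i ir; rewrite /= mulf_eq0 => /orP[/eqP->|]; first by rewrite mul0r.
by move=> /eqP/powR_eq0_eq0 ->; rewrite mul0r mulr0.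
Qed.

Lemma wsum_hoelder (p q : R) (a b : I -> R) :
    0 < p -> 0 < q -> p^-1 + q^-1 = 1 ->
    (forall i, 0 <= a i) -> (forall i, 0 <= b i) ->
  \sum_(i <- r) m i * (a i * b i) <=
  (\sum_(i <- r) m i * a i `^ p) `^ p^-1 *
  (\sum_(i <- r) m i * b i `^ q) `^ q^-1.
Proof.
move=> p0 q0 pq a_ge0 b_ge0.
set A := \sum_(i <- r) m i * a i `^ p; set B := \sum_(i <- r) m i * b i `^ q.
have A_ge0 : 0 <= A by apply: sumr_ge0 => i _; rewrite mulr_ge0 ?powR_ge0.
have B_ge0 : 0 <= B by apply: sumr_ge0 => i _; rewrite mulr_ge0 ?powR_ge0.
have [A0|A_neq0] := eqVneq A 0.
  by rewrite (wsum_mul_eq0 p)// mulr_ge0 ?powR_ge0.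
have [B0|B_neq0] := eqVneq B 0.
  under eq_bigr do rewrite [a _ * _]mulrC.
  by rewrite (wsum_mul_eq0 q)// mulr_ge0 ?powR_ge0.
have A_gt0 : 0 < A by rewrite lt_def A_neq0.
have B_gt0 : 0 < B by rewrite lt_def B_neq0.
apply: (@le_trans _ _ (A `^ p^-1 * B `^ q^-1 *
    \sum_(i <- r) m i * (a i `^ p / A / p + b i `^ q / B / q))).
  rewrite mulr_sumr; apply: ler_sum => i _.
  by rewrite [leRHS]mulrCA ler_wpM2l// young_normalized.
under eq_bigr do rewrite mulrDr !mulrA.
by rewrite big_split/= -!mulr_suml -/A -/B !divff// !mul1r pq mulr1.
Qed.

(** Hoelder's inequality against the constant function 1. The power p on the
    left is the homogeneity of the energy. *)
Lemma wsum_jensen (p : R) (a : I -> R) : 1 < p -> (forall i, 0 <= a i) ->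
  (\sum_(i <- r) m i * a i) `^ p <=
  (\sum_(i <- r) m i * a i `^ p) * (\sum_(i <- r) m i) `^ (p - 1).
Proof.
move=> p1 a_ge0.
have p0 : 0 < p by lra.
have p1' : 0 < p - 1 by lra.
have q0 : 0 < p / (p - 1) by rewrite divr_gt0.
have := @wsum_hoelder p (p / (p - 1)) a (fun=> 1) p0 q0 _ a_ge0 (fun=> ler01).
have -> : p^-1 + (p / (p - 1))^-1 = 1 by field; rewrite !gt_eqF.
under eq_bigr do rewrite mulr1.
under [X in X `^ (p / _)^-1]eq_bigr do rewrite powR1 mulr1.
move=> /(_ erefl) /(ge0_ler_powR (ltW p0)).
rewrite !nnegrE mulr_ge0 ?powR_ge0// sumr_ge0; last first.
  by move=> i _; rewrite mulr_ge0.
move=> /(_ isT isT) /le_trans; apply.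
rewrite powRM ?powR_ge0// -!powRrM mulVf ?gt_eqF// powRr1; last first.
  by apply: sumr_ge0 => i _; rewrite mulr_ge0 ?powR_ge0.
by rewrite invf_div mulrAC -mulrA divff ?gt_eqF// mulr1.
Qed.

End WeightedHoelder.

(** * Power sums *)

Section PowerSums.
Context {R : realType}.
Implicit Types (a e x y : R) (n m : nat).

(** The exponential lies above its tangent lines; here at [e * ln x]. Because e
    may have either sign, this one inequality replaces the mean value theorem
    both for growing and for decaying powers. *)
Lemma powR_ln_tangent e x y : 0 < x -> 0 < y ->
  x `^ e * (1 + e * (ln y - ln x)) <= y `^ e.
Proof.
move=> x0 y0; rewrite /powR !gt_eqF//.
have -> : e * ln y = e * ln x + e * (ln y - ln x) by ring.
by rewrite expRD ler_wpM2l ?expR_ge0// expR_ge1Dx.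
Qed.

Lemma ln_sub_ge x y : 0 < x -> 0 < y -> (y - x) / y <= ln y - ln x.
Proof.
move=> x0 y0.
have xy : 0 < x / y by rewrite divr_gt0.
have := @le_ln1Dx R (x / y - 1).
rewrite subrKC ln_div ?posrE// mulrBl divff ?gt_eqF// => H.
have := H ltac:(lra); lra.
Qed.

Lemma invS_le_lnB n : n.+2%:R^-1 <= ln n.+2%:R - ln n.+1%:R :> R.
Proof.
apply: le_trans (ln_sub_ge _ _ _ _); rewrite ?ltr0n//.
by rewrite -natrB// subSnn mul1r.
Qed.

Lemma natS_le_double n : (0 < n)%N -> n.+1%:R <= 2 * n%:R :> R.
Proof. by move=> n0; rewrite -natrM ler_nat mul2n -addnn -addn1 leq_add2l. Qed.

Lemma powRS_le e n : 0 <= e -> (0 < n)%N ->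
  n.+1%:R `^ e <= 2 `^ e * n%:R `^ e :> R.
Proof.
by move=> e0 n0; rewrite -powRM// ge0_ler_powR ?nnegrE ?mulr_ge0//
  natS_le_double.
Qed.

Lemma powR_pred e n : n.+1%:R `^ (e - 1) = n.+1%:R `^ e / n.+1%:R :> R.
Proof. by rewrite powRB ?powRr1// pnatr_eq0 implybT. Qed.

(** Each term is at most [2 `^ e / e] times the increment of [k `^ e], so the sum
    telescopes; the summand 1 in the constant pays for the first term, which has
    no predecessor. *)
Lemma sum_powR_le e m : 0 < e ->
  \sum_(0 <= k < m) k.+1%:R `^ (e - 1) <= (1 + 2 `^ e / e) * m%:R `^ e.
Proof.
move=> e0.
have C0 : 0 <= 2 `^ e / e by rewrite divr_ge0 ?powR_ge0 ?ltW.
elim: m => [|[|m] IH].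
- by rewrite big_nil mulr_ge0 ?powR_ge0 ?addr_ge0.
- by rewrite big_nat1 !powR1 mulr1 lerDl.
rewrite big_nat_recr//=; apply: le_trans (lerD IH (lexx _)) _.
rewrite -lerBrDl -mulrBr powR_pred.
have t : m.+1%:R `^ e * e * m.+2%:R^-1 <= m.+2%:R `^ e - m.+1%:R `^ e :> R.
  have := powR_ln_tangent e m.+1%:R m.+2%:R.
  rewrite !ltr0n => /(_ isT isT); rewrite mulrDr mulr1 -lerBrDl mulrA.
  by apply: le_trans; rewrite ler_wpM2l ?invS_le_lnB// mulr_ge0 ?powR_ge0 ?ltW.
have d0 : 0 <= m.+2%:R `^ e - m.+1%:R `^ e :> R.
  by apply: le_trans t; rewrite !mulr_ge0 ?powR_ge0 ?ltW ?invr_gt0 ?ltr0n.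
apply: (@le_trans _ _ (2 `^ e / e * (m.+1%:R `^ e * e * m.+2%:R^-1))).
  rewrite (_ : _ / e * _ = 2 `^ e * m.+1%:R `^ e / m.+2%:R); last first.
    by field; rewrite ?gt_eqF// pnatr_eq0.
  by rewrite ler_wpM2r ?invr_ge0 ?powRS_le ?ltW.
by rewrite ler_pM// ?lerDr// !mulr_ge0 ?powR_ge0 ?ltW ?invr_gt0 ?ltr0n.
Qed.

(** Each term is at most [2 `^ (a + 1) / a] times the decrement of
    [k.+1 `^ (- a)], so the sum telescopes to a bound independent of m. *)
Lemma sum_powR_tail_le a n m : 0 < a ->
  \sum_(n <= k < m) k.+1%:R `^ (- a - 1) <= 2 `^ (a + 1) / a * n.+1%:R `^ (- a).
Proof.
move=> a0.
have C0 : 0 <= 2 `^ (a + 1) / a by rewrite divr_ge0 ?powR_ge0 ?ltW.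
case: (leqP n m) => [nm|/ltnW mn]; last first.
  by rewrite big_geq// mulr_ge0 ?powR_ge0.
pose f k : R := - (2 `^ (a + 1) / a * k.+1%:R `^ (- a)).
apply: (@le_trans _ _ (\sum_(n <= k < m) (f k.+1 - f k))); last first.
  rewrite telescope_sumr// /f opprK addrC lerBlDr lerDl.
  by rewrite mulr_ge0 ?powR_ge0.
apply: ler_sum => k _.
rewrite /f opprK [leRHS]addrC -mulrBr.
have t : a * k.+2%:R `^ (- a - 1) <= k.+1%:R `^ (- a) - k.+2%:R `^ (- a) :> R.
  have := powR_ln_tangent (- a) k.+2%:R k.+1%:R.
  rewrite !ltr0n => /(_ isT isT); rewrite mulrDr mulr1 -lerBrDl.
  apply: le_trans; rewrite powR_pred mulrCA ler_wpM2l ?powR_ge0//.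
  by rewrite mulNr -mulrN opprB ler_wpM2l ?invS_le_lnB ?ltW.
apply: le_trans (ler_wpM2l C0 t).
rewrite mulrA divfK ?gt_eqF//.
rewrite (_ : - a - 1 = - (a + 1)); last by rewrite opprD.
rewrite !powRN ler_pdivlMr ?powR_gt0 ?ltr0n//.
rewrite mulrC ler_pdivrMr ?powR_gt0 ?ltr0n//.
by apply: powRS_le => //; lra.
Qed.

Lemma sum_inv_le m : \sum_(0 <= k < m.+1) k.+1%:R^-1 <= 1 + ln m.+1%:R :> R.
Proof.
elim: m => [|m IH]; first by rewrite big_nat1 ln1 addr0 invr1.
rewrite big_nat_recr//= (le_trans (lerD IH (invS_le_lnB m)))//.
by rewrite -addrA subrKC.
Qed.

Lemma sum_fset_le_nat (f : nat -> R) (A : {fset nat}) m :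
    (forall k, 0 <= f k) -> (forall k, k \in A -> (k < m)%N) ->
  \sum_(k <- A) f k <= \sum_(0 <= k < m) f k.
Proof.
move=> f_ge0 Am; rewrite [leRHS](bigID (mem A))/= -[leLHS]addr0.
apply: lerD; last by apply: sumr_ge0.
rewrite -[leRHS]big_filter (perm_big [seq k <- index_iota 0 m | k \in A])//.
apply: uniq_perm; rewrite ?filter_uniq ?iota_uniq ?fset_uniq// => k.
rewrite mem_filter mem_index_iota.
by have [/Am->|] := boolP (k \in A).
Qed.

End PowerSums.

(** * From the resistance of the path to the eigenvalue *)

Section RadialEstimates.
Context {R : realType}.
Variables (D p : R).
Implicit Types (u w : nat -> R) (n m k : nat).

Definition path_energy m u : R :=
  \sum_(0 <= k < m) k.+1%:R `^ (D - 1) * `|u k - u k.+1| `^ p.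

(** The effective p-resistance between n and m of the path with conductances
    [k.+1 `^ (D - 1)]: in series, the powers [-1 / (p - 1)] of the conductances
    add up. *)
Definition resistance n m : R :=
  \sum_(n <= k < m) k.+1%:R `^ (- ((D - 1) / (p - 1))).

Lemma resistance_ge0 n m : 0 <= resistance n m.
Proof. by apply: sumr_ge0 => k _; exact: powR_ge0. Qed.

Lemma radial_mu_ge0 n : 0 <= radial_mu D n.
Proof. exact: powR_ge0. Qed.

(** Every edge occurs in the double sum in its two orientations, which the
    factor 1/2 of the energy compensates. *)
Lemma path_energy_le m u :
  ((path_energy m u)%:E <= energy (radial_omega D) p u)%E.
Proof.
pose fwd k := (k, k.+1); pose bwd k := (k.+1, k).
pose s := map fwd (index_iota 0 m) ++ map bwd (index_iota 0 m).
have us : uniq s.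
  rewrite cat_uniq !map_inj_uniq ?iota_uniq//=; last 2 first.
  - by move=> i j [].
  - by move=> i j [].
  rewrite andbT; apply/hasPn => _ /mapP[i _ ->]; apply/mapP => -[j _ [ij ji]].
  by have := leqnn i; rewrite {1}ji -ij ltnNge leqnSn.
have hs : (2^-1 * (path_energy m u + path_energy m u) = path_energy m u)%R.
  by field.
rewrite -{}hs EFinM; apply: lee_wpmul2l; first by rewrite lee_fin invr_ge0.
apply: esum_ge; exists [set` s]%classic; first by split => //;
  exact: finite_seq.
rewrite -fsbig_seq// sumEFin lee_fin big_cat/= !big_map.
rewrite /path_energy !big_seq lerD//; apply: ler_sum => k _ /=.
- rewrite /radial_omega /radial_adj eqxx/= (minn_idPl (leqnSn k)).
  by rewrite distrC.
- by rewrite /radial_omega /radial_adj eqxx orbT (minn_idPr (leqnSn k)).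
Qed.

(** Jensen's inequality with the weights
    [rho k = k.+1 `^ (- ((D - 1) / (p - 1)))], for which
    [rho k * (d / rho k) `^ p = k.+1 `^ (D - 1) * d `^ p]: the weighted p-th power
    sum is the energy and the total weight is the resistance. *)
Lemma powR_le_energy u m n : 1 < p -> (n <= m)%N -> u m = 0 ->
  `|u n| `^ p <= resistance n m `^ (p - 1) * path_energy m u.
Proof.
move=> p1 nm um.
pose rho k : R := k.+1%:R `^ (- ((D - 1) / (p - 1))).
have rho_gt0 k : 0 < rho k by rewrite powR_gt0 ?ltr0n.
have un : `|u n| <= \sum_(n <= k < m) rho k * (`|u k - u k.+1| / rho k).
  under eq_bigr do rewrite mulrC divfK ?gt_eqF//.
  have := telescope_sumr (fun k => - u k) nm.
  rewrite um oppr0 opprK add0r => <-.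
  rewrite (le_trans (ler_norm_sum _ _ _))//; apply: ler_sum => k _.
  by rewrite opprK addrC.
have p0 : 0 <= p by lra.
have rho_ge0 k : 0 <= rho k by exact: ltW.
have un0 : 0 <= \sum_(n <= k < m) rho k * (`|u k - u k.+1| / rho k).
  exact: le_trans un.
apply: le_trans (ge0_ler_powR p0 _ _ un) _; rewrite ?nnegrE//.
have := @wsum_jensen R nat (index_iota n m) rho rho_ge0 p
  (fun k => `|u k - u k.+1| / rho k) p1.
move=> /(_ (fun k => divr_ge0 (normr_ge0 _) (rho_ge0 k))) /le_trans; apply.
rewrite mulrC ler_wpM2l ?powR_ge0//.
rewrite /path_energy (big_cat_nat (leq0n n) nm)/= -[leLHS]add0r lerD//.
  by apply: sumr_ge0 => k _; rewrite mulr_ge0 ?powR_ge0.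
apply: ler_sum => k _.
rewrite powRM ?invr_ge0// mulrCA [leLHS]mulrC ler_wpM2r ?powR_ge0//.
rewrite -powR_inv1// -powRrM mulN1r -{1}(powRr1 (rho_ge0 k)) -powRD; last first.
  by rewrite (gt_eqF (rho_gt0 k)) implybT.
rewrite /rho -powRrM.
by rewrite (_ : - _ * _ = D - 1)//; field; rewrite gt_eqF// subr_gt0.
Qed.

Lemma outer_radius_ge (Omega : {fset nat}) k :
  k \in Omega -> (k <= outer_radius Omega)%N.
Proof. by move=> kO; rewrite /outer_radius; exact: leq_bigmax_seq. Qed.

Lemma lambda1_ge (Omega : {fset nat}) w (kappa : R) :
    1 < p -> 0 <= kappa -> (forall x, x \in Omega -> 0 <= w x) ->
    kappa * \sum_(x <- Omega) radial_mu D x * w x *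
      resistance x (outer_radius Omega).+1 `^ (p - 1) <= 1 ->
  (kappa%:E <= radial_lambda1 D p Omega w)%E.
Proof.
move=> p1 kappa0 w0 hk.
apply: le_ereal_inf_tmp => _ [u [u0 mass0] <-].
rewrite inver gt_eqF// lee_pdivlMr// -EFinM.
apply: le_trans (path_energy_le (outer_radius Omega).+1 u).
set m := (outer_radius Omega).+1 in hk *.
rewrite lee_fin.
have um : u m = 0.
  apply: u0; apply/negP => /outer_radius_ge; by rewrite ltnn.
have E0 : 0 <= path_energy m u.
  by apply: sumr_ge0 => k _; rewrite mulr_ge0 ?powR_ge0.
apply: (@le_trans _ _ ((kappa * \sum_(x <- Omega) radial_mu D x * w x *
      resistance x m `^ (p - 1)) * path_energy m u)); last first.
  by rewrite -[leRHS]mul1r ler_wpM2r.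
rewrite -mulrA ler_wpM2l// /wmass mulr_suml [leLHS]big_seq [leRHS]big_seq.
apply: ler_sum => x xO.
rewrite -[leRHS]mulrA ler_wpM2l ?mulr_ge0 ?radial_mu_ge0 ?w0//.
by rewrite powR_le_energy//; apply: leq_trans (outer_radius_ge _ _ xO) _.
Qed.

(** The form in which a bound on the sum of resistances is used. The case
    [K = 0] is covered by [0^-1 = 0], so that no positivity of the norm of w
    has to be proved. *)
Lemma lambda1_ge_div (Omega : {fset nat}) w (C K : R) :
    1 < p -> 0 < C -> 0 <= K -> (forall x, x \in Omega -> 0 <= w x) ->
    \sum_(x <- Omega) radial_mu D x * w x *
      resistance x (outer_radius Omega).+1 `^ (p - 1) <= C * K ->
  ((C^-1 / K)%:E <= radial_lambda1 D p Omega w)%E.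
Proof.
move=> p1 C0 K0 w0 SK.
have CK0 : 0 <= C^-1 / K by rewrite divr_ge0// invr_ge0 ltW.
apply: lambda1_ge => //.
apply: le_trans (ler_wpM2l CK0 SK) _.
have [->|Kn0] := eqVneq K 0; first by rewrite invr0 mulr0 mul0r ler01.
by rewrite mulrACA mulVf ?gt_eqF// mulVf ?mul1r.
Qed.

Lemma sum_resistance_le (Omega : {fset nat}) w m (B : R) :
    1 < p -> (forall x, x \in Omega -> 0 <= w x) -> resistance 0 m <= B ->
  \sum_(x <- Omega) radial_mu D x * w x * resistance x m `^ (p - 1) <=
  B `^ (p - 1) * radial_lnorm D Omega 1 w.
Proof.
move=> p1 w0 rB.
rewrite /radial_lnorm /lnorm invr1 powRr1; last first.
  by apply: sumr_ge0 => x _; rewrite mulr_ge0 ?powR_ge0 ?radial_mu_ge0.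
rewrite mulr_sumr [leLHS]big_seq [leRHS]big_seq; apply: ler_sum => x xO.
rewrite powRr1// ger0_norm ?w0// mulrC ler_wpM2r ?mulr_ge0 ?radial_mu_ge0 ?w0//.
have B0 : 0 <= B := le_trans (resistance_ge0 _ _) rB.
rewrite ge0_ler_powR ?nnegrE ?resistance_ge0//; first by lra.
apply: le_trans rB; have [xm|/ltnW mx] := leqP x m; last first.
  by rewrite {1}/resistance big_geq ?resistance_ge0.
rewrite /resistance [leRHS](big_cat_nat (leq0n x) xm)/= -[leLHS]add0r lerD//.
exact: resistance_ge0.
Qed.

End RadialEstimates.

(** * The three regimes *)

Section RadialEigenvalue.
Context {R : realType}.
Variable D : R.
Hypothesis D1 : 1 < D.
Implicit Types (Omega : {fset nat}) (w : nat -> R).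

Lemma radial_lnorm_ge0 Omega r w : 0 <= radial_lnorm D Omega r w.
Proof. exact: powR_ge0. Qed.

Lemma sum_powR_upto_le (e : R) : 0 < e ->
  exists2 C : R, 0 < C & forall m, (0 < m)%N ->
    \sum_(0 <= k < m.+1) k.+1%:R `^ (e - 1) <= C * m%:R `^ e.
Proof.
move=> e0; exists ((1 + 2 `^ e / e) * 2 `^ e).
  by rewrite mulr_gt0 ?powR_gt0 ?addr_gt0 ?divr_gt0 ?powR_gt0.
move=> m m0; apply: le_trans (sum_powR_le e m.+1 e0) _.
rewrite -mulrA ler_wpM2l ?powRS_le// ?(ltW e0)//.
by rewrite addr_ge0// divr_ge0 ?powR_ge0 ?ltW.
Qed.

Lemma radial_lambda1_supercritical (p : R) : D < p ->
  exists2 c : R, 0 < c & forall Omega w,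
    (0 < outer_radius Omega)%N -> (forall x, x \in Omega -> 0 <= w x) ->
    ((c / ((outer_radius Omega)%:R `^ (p - D) * radial_lnorm D Omega 1 w))%:E
      <= radial_lambda1 D p Omega w)%E.
Proof.
move=> Dp; have p1 : 1 < p by exact: lt_trans Dp.
have p1' : 0 < p - 1 by rewrite subr_gt0.
have e0 : 0 < (p - D) / (p - 1) by rewrite divr_gt0// subr_gt0.
have [C C0 Cle] := sum_powR_upto_le _ e0.
exists (C `^ (p - 1))^-1; first by rewrite invr_gt0 powR_gt0.
move=> Omega w t0 w0.
apply: lambda1_ge_div => //.
- exact: powR_gt0.
- by rewrite mulr_ge0 ?powR_ge0 ?radial_lnorm_ge0.
have rB : resistance D p 0 (outer_radius Omega).+1 <=
    C * (outer_radius Omega)%:R `^ ((p - D) / (p - 1)).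
  rewrite /resistance (_ : - _ = (p - D) / (p - 1) - 1) ?Cle//.
  by field; rewrite gt_eqF.
apply: le_trans (sum_resistance_le _ _ _ _ _ _ p1 w0 rB) _.
rewrite powRM ?powR_ge0 ?(ltW C0)// -powRrM divfK ?gt_eqF//.
by rewrite mulrA.
Qed.

Lemma radial_lambda1_critical :
  exists2 c : R, 0 < c & forall Omega w,
    (1 < outer_radius Omega)%N -> (forall x, x \in Omega -> 0 <= w x) ->
    ((c / (ln (outer_radius Omega)%:R `^ (D - 1) * radial_lnorm D Omega 1 w))%:E
      <= radial_lambda1 D D Omega w)%E.
Proof.
have ln2 : 0 < ln 2 :> R by rewrite ln_gt0 ?ltr1n.
(* 1 + ln (t + 1) <= (1 + ln 2) + ln t, and 1 <= ln t / ln 2 *)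
pose C : R := (1 + ln 2) / ln 2 + 1.
have C0 : 0 < C by rewrite /C addr_gt0// divr_gt0// addr_gt0.
exists (C `^ (D - 1))^-1; first by rewrite invr_gt0 powR_gt0.
move=> Omega w t1 w0.
set t := outer_radius Omega in t1 *.
have t0 : (0 < t)%N by exact: ltnW.
have lt2 : ln 2 <= ln t%:R :> R.
  by rewrite ler_ln ?posrE ?ltr0n// ler_nat.
apply: lambda1_ge_div => //.
- exact: powR_gt0.
- by rewrite mulr_ge0 ?powR_ge0 ?radial_lnorm_ge0.
have rB : resistance D D 0 t.+1 <= C * ln t%:R.
  rewrite /resistance divff ?gt_eqF ?subr_gt0//.
  under eq_bigr do rewrite powR_inv1//.
  apply: le_trans (sum_inv_le t) _.
  have lS : ln t.+1%:R <= ln 2 + ln t%:R :> R.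
    by rewrite -lnM ?posrE ?ltr0n// ler_ln ?posrE ?mulr_gt0 ?ltr0n//
      natS_le_double.
  apply: le_trans (lerD (lexx 1) lS) _.
  rewrite addrA /C mulrDl mul1r lerD2r mulrAC -mulrA.
  rewrite -[leLHS]mulr1 ler_wpM2l//; first by rewrite addr_ge0// ltW.
  by rewrite ler_pdivlMr// mul1r.
apply: le_trans (sum_resistance_le _ _ _ _ _ _ D1 w0 rB) _.
rewrite powRM ?(ltW C0)//; last exact: le_trans (ltW ln2) lt2.
by rewrite mulrA.
Qed.

(** For p < D the resistance to infinity is finite, which is why the bound does
    not depend on m. *)
Lemma resistance_powR_le (p : R) : 1 < p -> p < D ->
  exists2 C : R, 0 < C & forall n m,
    resistance D p n m `^ (p - 1) <= C * n.+1%:R `^ (p - D).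
Proof.
move=> p1 pD.
have p1' : 0 < p - 1 by rewrite subr_gt0.
pose a := (D - p) / (p - 1).
have a0 : 0 < a by rewrite divr_gt0// subr_gt0.
pose B : R := 2 `^ (a + 1) / a.
have B0 : 0 < B by rewrite divr_gt0 ?powR_gt0.
exists (B `^ (p - 1)); first exact: powR_gt0.
move=> n m.
have -> : p - D = - a * (p - 1) by rewrite /a; field; rewrite gt_eqF.
rewrite powRrM -powRM ?powR_ge0 ?(ltW B0)//.
rewrite ge0_ler_powR ?nnegrE ?resistance_ge0 ?(ltW p1')//.
  by rewrite mulr_ge0 ?powR_ge0 ?(ltW B0).
rewrite /resistance (_ : - _ = - a - 1) ?sum_powR_tail_le//.
by rewrite /a; field; rewrite gt_eqF.
Qed.

Lemma radial_lambda1_subcritical (p s : R) : 1 < p -> p < D -> D / p < s ->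
  exists2 c : R, 0 < c & forall Omega w,
    (0 < outer_radius Omega)%N -> (forall x, x \in Omega -> 0 <= w x) ->
    ((c / ((outer_radius Omega)%:R `^ (p - D / s) * radial_lnorm D Omega s w))%:E
      <= radial_lambda1 D p Omega w)%E.
Proof.
move=> p1 pD Dps.
have p0 : 0 < p by exact: lt_trans p1.
have s1 : 1 < s by apply: lt_trans Dps; rewrite ltr_pdivlMr// mul1r.
have s0 : 0 < s by exact: lt_trans s1.
have s1' : 0 < s - 1 by rewrite subr_gt0.
pose t := s / (s - 1).
have t0 : 0 < t by rewrite divr_gt0.
have st : s^-1 + t^-1 = 1 by rewrite /t; field; rewrite !gt_eqF.
pose e := D + (p - D) * t.
have eE : e / t = p - D / s by rewrite /e /t; field; rewrite !gt_eqF.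
(* this is where s > D / p enters *)
have e0 : 0 < e.
  rewrite -(mulfVK (lt0r_neq0 t0) e) eE mulr_gt0// subr_gt0.
  by rewrite ltr_pdivrMr// mulrC -ltr_pdivrMr.
have [C C0 Cle] := resistance_powR_le _ p1 pD.
have [B B0 Ble] := sum_powR_upto_le _ e0.
exists (C * B `^ t^-1)^-1; first by rewrite invr_gt0 mulr_gt0 ?powR_gt0.
move=> Omega w r0 w0; set r := outer_radius Omega in r0 *.
apply: lambda1_ge_div => //.
- by rewrite mulr_gt0 ?powR_gt0.
- by rewrite mulr_ge0 ?powR_ge0 ?radial_lnorm_ge0.
have -> : C * B `^ t^-1 * (r%:R `^ (p - D / s) * radial_lnorm D Omega s w) =
    C * (radial_lnorm D Omega s w * (B * r%:R `^ e) `^ t^-1).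
  rewrite powRM ?powR_ge0 ?(ltW B0)// -[in RHS]powRrM eE; ring.
apply: (@le_trans _ _ (C * \sum_(x <- Omega)
    radial_mu D x * (`|w x| * x.+1%:R `^ (p - D)))).
  rewrite mulr_sumr [leLHS]big_seq [leRHS]big_seq; apply: ler_sum => x xO.
  rewrite ger0_norm ?w0// mulrCA -[leLHS]mulrA ler_wpM2l ?radial_mu_ge0//.
  by rewrite mulrCA ler_wpM2l ?w0.
rewrite ler_wpM2l ?(ltW C0)//.
apply: le_trans (wsum_hoelder Omega (radial_mu D) (radial_mu_ge0 D) s t
  (fun x => `|w x|) (fun x => x.+1%:R `^ (p - D)) s0 t0 st
  (fun=> normr_ge0 _) (fun=> powR_ge0 _ _)) _.
rewrite /radial_lnorm /lnorm ler_wpM2l ?powR_ge0//.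
have mt x : radial_mu D x * (x.+1%:R `^ (p - D)) `^ t = x.+1%:R `^ (e - 1).
  rewrite /radial_mu -powRrM -powRD ?pnatr_eq0 ?implybT//.
  by congr (_ `^ _); rewrite /e; ring.
under eq_bigr do rewrite mt.
have t'0 : 0 <= t^-1 by rewrite invr_ge0 ltW.
apply: (ge0_ler_powR t'0); rewrite ?nnegrE.
- by apply: sumr_ge0 => x _; exact: powR_ge0.
- by rewrite mulr_ge0 ?powR_ge0 ?(ltW B0).
apply: le_trans (Ble _ r0); apply: sum_fset_le_nat => [k|k kO].
  exact: powR_ge0.
by rewrite ltnS outer_radius_ge.
Qed.

End RadialEigenvalue.

Theorem corollary4p4 (R : realType) (D : R) (hD : 1 < D) :
  [/\ (forall p : R, D < p ->
        exists2 c : R, 0 < c &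
          forall (Omega : {fset nat}) (w : nat -> R),
            Omega != fset0 -> (2 <= outer_radius Omega)%N ->
            weight_on Omega w ->
            ((c / ((outer_radius Omega)%:R `^ (p - D) *
                   radial_lnorm D Omega 1 w))%:E
              <= radial_lambda1 D p Omega w)%E),
      (forall p : R, p = D ->
        exists2 c : R, 0 < c &
          forall (Omega : {fset nat}) (w : nat -> R),
            Omega != fset0 -> (2 <= outer_radius Omega)%N ->
            weight_on Omega w ->
            ((c / (ln (outer_radius Omega)%:R `^ (p - 1) *
                   radial_lnorm D Omega 1 w))%:E
              <= radial_lambda1 D p Omega w)%E)
    & (forall p s : R, 1 < p -> p < D -> D / p < s ->
        exists2 c : R, 0 < c &
          forall (Omega : {fset nat}) (w : nat -> R),
            Omega != fset0 -> (2 <= outer_radius Omega)%N ->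
            weight_on Omega w ->
            ((c / ((outer_radius Omega)%:R `^ (p - D / s) *
                   radial_lnorm D Omega s w))%:E
              <= radial_lambda1 D p Omega w)%E)].
Proof.
split.
- move=> p Dp; have [c c0 cP] := radial_lambda1_supercritical D hD p Dp.
  by exists c => // Omega w _ t2 [w0 _]; apply: cP => //; exact: ltnW.
- move=> p ->; have [c c0 cP] := radial_lambda1_critical D hD.
  by exists c => // Omega w _ t2 [w0 _]; exact: cP.
- move=> p s p1 pD Dps.
  have [c c0 cP] := radial_lambda1_subcritical D p s p1 pD Dps.
  by exists c => // Omega w _ t2 [w0 _]; apply: cP => //; exact: ltnW.
Qed.
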